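(* Let $m,n\ge1$ be integers with $m+n>3$. The multigraph $T_{m\times n}$ supports a nullhomotopic tour if and only if at least one of $m$ or $n$ is even.
   Context: A knight pair is an ordered pair of integers $(x,y)$ with $\{|x|,|y|\}=\{1,2\}$. For positive integers $m,n$, the multigraph (possibly with loops) $T_{m\times n}$ (knight's graph of the $m\times n$ torus) has vertex set $\{(a,b)\in\mathbb{Z}^2 : 0\le a\le m-1,\ 0\le b\le n-1\}$. A toroidal jump is a knight pair $(x,y)$ together with a vertex $(a,b)$; it joins $(a,b)$ to $((a+x)\bmod m,(b+y)\bmod n)$. The jumps $(x,y),(a,b)$ and $(-x,-y),((a+x)\bmod m,(b+y)\bmod n)$ are declared equivalent, and $T_{m\times n}$ has exactly one edge for each equivalence class. Let $T=\mathbb{R}^2/(m\mathbb{Z}\times n\mathbb{Z})$ be the torus with base point $t_0=(1/2,1/2)$. Define $j_t$ sending vertex $(a,b)$ to $(a+1/2,b+1/2)$ and the edge given by the jump $(x,y),(a,b)$ to the path $s\mapsto (a+1/2+xs,\,b+1/2+ys)$ mod $(m\mathbb{Z}\times n\mathbb{Z})$, $s\in[0,1]$ (well defined up to reversal). A tour on $T_{m\times n}$ is a Hamiltonian cycle based at $(0,0)$: if $mn=1$ it is the constant loop at $(0,0)$; otherwise it is a cyclic sequence $(0,0)=v_0,v_1,\dots,v_{mn-1}$ listing every vertex exactly once, together with pairwise distinct edges $e_0,\dots,e_{mn-1}$ where $e_i$ joins $v_i$ and $v_{i+1}$ (indices mod $mn$). Traversing $j_t(e_0),\dots,j_t(e_{mn-1})$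 in order gives a loop in $T$ based at $t_0$. The tour is nullhomotopic if this loop represents the identity of $\pi_1(T,t_0)$. $T_{m\times n}$ supports a nullhomotopic tour if some tour on it is nullhomotopic. *)

(* Defs.v *)
From mathcomp Require Import all_boot all_order all_algebra generic_quotient.
From mathcomp Require Import ring zify.
From mathcomp Require Import all_classical all_reals all_analysis.
Import Order.TTheory GRing.Theory Num.Theory.
Import numFieldNormedType.Exports.

Set Implicit Arguments.
Unset Strict Implicit.
Unset Printing Implicit Defensive.

Local Open Scope classical_set_scope.
Local Open Scope ring_scope.
Local Open Scope quotient_scope.

Definition knight_pair (p : int * int) : bool :=
  (`|p.1|%N, `|p.2|%N) \in [:: (1, 2); (2, 1)]%N.

Section KnightGraph.
Variables m n : nat.

Definition vertex : Type := 'I_m * 'I_n.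

Lemma shift_subproof (k : nat) (i : 'I_k) (x : int) :
  (`|((i%:Z + x) %% k)%Z|%N < k)%N.
Proof.
have k0 : (k%:Z != 0) by case: i => i /= ik; lia.
have := modz_ge0 (i%:Z + x) k0; have := ltz_mod (i%:Z + x) k0; lia.
Qed.

(* (i + x) mod k *)
Definition shift (k : nat) (i : 'I_k) (x : int) : 'I_k :=
  Ordinal (shift_subproof i x).

Lemma val_shift k (i : 'I_k) x : (shift i x)%:Z = ((i%:Z + x) %% k)%Z.
Proof.
have k0 : (k%:Z != 0) by case: i => i /= ik; lia.
by rewrite /= gez0_abs // modz_ge0.
Qed.

Lemma shiftK k (i : 'I_k) x : shift (shift i x) (- x) = i.
Proof.
apply/val_inj; apply: (can_inj absz_nat).
rewrite val_shift val_shift modzDml addrK modz_small //=.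
exact: ltn_ord.
Qed.

Definition jump : Type := {j : (int * int) * vertex | knight_pair j.1}.

Definition jump_dir (j : jump) : int * int := (val j).1.
Definition jump_src (j : jump) : vertex := (val j).2.
Definition jump_tgt (j : jump) : vertex :=
  (shift (jump_src j).1 (jump_dir j).1, shift (jump_src j).2 (jump_dir j).2).

Lemma jump_rev_subproof (j : jump) :
  knight_pair (- (jump_dir j).1, - (jump_dir j).2).
Proof. by have := valP j; rewrite /knight_pair /= !abszN. Qed.

Definition jump_rev (j : jump) : jump :=
  exist (fun k : (int * int) * vertex => knight_pair k.1)
    ((- (jump_dir j).1, - (jump_dir j).2), jump_tgt j) (jump_rev_subproof j).

Lemma jump_revK : involutive jump_rev.
Proof.
move=> j; apply/val_inj => /=.
case: j => [[[x y] [a b]] ?].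
rewrite /jump_rev /jump_tgt /jump_dir /jump_src /=.
by rewrite !shiftK !opprK.
Qed.

Definition jump_equiv (j k : jump) : bool := (k == j) || (k == jump_rev j).

Lemma jump_equiv_refl : reflexive jump_equiv.
Proof. by move=> j; rewrite /jump_equiv eqxx. Qed.

Lemma jump_equiv_sym : symmetric jump_equiv.
Proof.
move=> j k; rewrite /jump_equiv eq_sym; congr (_ || _).
by apply/eqP/eqP => ->; rewrite jump_revK.
Qed.

Lemma jump_equiv_trans : transitive jump_equiv.
Proof.
move=> k j l /orP[/eqP->//|/eqP->] /orP[/eqP->|/eqP->].
  by rewrite /jump_equiv eqxx orbT.
by rewrite jump_revK jump_equiv_refl.
Qed.

Canonical jump_equivRel :=
  EquivRel jump_equiv jump_equiv_refl jump_equiv_sym jump_equiv_trans.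

Definition edge : Type := {eq_quot jump_equiv}.

Definition joins (e : edge) (u v : vertex) : Prop :=
  exists j : jump, [/\ \pi_edge j = e, jump_src j = u & jump_tgt j = v].

(* The tour of the one-vertex graph is the constant one and uses no edge.
   In the other constructor, ordS is the cyclic successor on indices. *)
Inductive tour : Type :=
| ConstantTour of (m * n = 1)%N
| HamiltonianTour (v : 'I_(m * n) -> vertex) (e : 'I_(m * n) -> edge) of
    (m * n <> 1)%N
  & bijective v
  & (forall i : 'I_(m * n), i = 0%N :> nat ->
       (v i).1 = 0%N :> nat /\ (v i).2 = 0%N :> nat)
  & injective e
  & (forall i, joins (e i) (v i) (v (ordS i))).

(* The representative of e that starts at u. If e joins u to some v != u, then
   it is unique, since the class e consists of one jump from u and one from v. *)
Definition orient (e : edge) (u : vertex) : jump :=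
  if jump_src (repr e) == u then repr e else jump_rev (repr e).

Lemma orientP e u v : joins e u v ->
  [/\ \pi_edge (orient e u) = e, jump_src (orient e u) = u
    & jump_tgt (orient e u) = v].
Proof.
move=> [j [<- <- <-]]; set r := repr (\pi_edge j).
have piE : \pi_edge (jump_rev r) = \pi_edge r.
  by apply/esym/eqmodP; rewrite /= /jump_equiv eqxx orbT.
have piR : \pi_edge r = \pi_edge j by rewrite reprK.
have tgtrev k : jump_tgt (jump_rev k) = jump_src k.
  by rewrite -[in RHS](jump_revK k).
rewrite /orient -/r.
have /eqmodP/= /orP[/eqP jr|/eqP jr] := piR; first by rewrite jr eqxx.
case: eqP => [rj|_]; last by rewrite piE piR jr.
by split=> //; rewrite [in RHS]jr tgtrev rj jr.
Qed.

End KnightGraph.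

Section Paths.
Variables (R : realType) (X : topologicalType).
Implicit Types (x : X) (f g : R -> X).

Definition path_concat f g : R -> X :=
  fun s => if s <= 2^-1 then f (2 * s) else g (2 * s - 1).

Definition is_loop x f : Prop :=
  [/\ {within `[0, 1], continuous f}, f 0 = x & f 1 = x].

Definition loop_homotopic x f g : Prop :=
  exists H : R * R -> X,
    [/\ {within `[0, 1] `*` `[0, 1], continuous H},
        forall s, s \in `[0, 1] -> H (s, 0) = f s /\ H (s, 1) = g s
      & forall t, t \in `[0, 1] -> H (0, t) = x /\ H (1, t) = x].

Definition nullhomotopic x f : Prop :=
  is_loop x f /\ loop_homotopic x f (cst x).

End Paths.

Section Torus.
Variables (R : realType) (m n : nat).

Definition torus_rel (p q : R * R) : bool :=
  `[< exists k l : int, q.1 - p.1 = k%:~R * m%:R /\ q.2 - p.2 = l%:~R * n%:R >].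

Lemma torus_rel_refl : reflexive torus_rel.
Proof. by move=> p; apply/asboolP; exists 0, 0; rewrite !subrr !mul0r. Qed.

Lemma torus_rel_sym : symmetric torus_rel.
Proof.
have sub p q : torus_rel p q -> torus_rel q p.
  move=> /asboolP[k [l [pq1 pq2]]]; apply/asboolP; exists (- k), (- l).
  by rewrite !mulrNz !mulNr -pq1 -pq2 !opprB.
by move=> p q; apply/idP/idP; exact: sub.
Qed.

Lemma torus_rel_trans : transitive torus_rel.
Proof.
move=> q p r /asboolP[k [l [pq1 pq2]]] /asboolP[k' [l' [qr1 qr2]]].
apply/asboolP; exists (k + k'), (l + l').
by rewrite !intrD !mulrDl -pq1 -pq2 -qr1 -qr2; split; ring.
Qed.

Canonical torus_equivRel :=
  EquivRel torus_rel torus_rel_refl torus_rel_sym torus_rel_trans.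

Definition torus : Type := quotient_topology {eq_quot torus_rel}.

Definition torus_base : torus := \pi_torus (2^-1, 2^-1).

Definition vertex_point (v : vertex m n) : torus :=
  \pi_torus (v.1%:R + 2^-1, v.2%:R + 2^-1).

Definition jump_path (j : jump m n) (s : R) : torus :=
  \pi_torus ((jump_src j).1%:R + 2^-1 + (jump_dir j).1%:~R * s,
             (jump_src j).2%:R + 2^-1 + (jump_dir j).2%:~R * s).

Lemma jump_path0 j : jump_path j 0 = vertex_point (jump_src j).
Proof. by rewrite /jump_path !mulr0 !addr0. Qed.

Lemma jump_path_rev j s : jump_path (jump_rev j) s = jump_path j (1 - s).
Proof.
have shiftE (k : nat) (i : 'I_k) (x : int) :
    (i%:R + x%:~R - (shift i x)%:R : R) = ((i%:Z + x) %/ k)%Z%:~R * k%:R.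
  rewrite -[(shift i x)%:R]/((shift i x)%:Z%:~R) val_shift -[i%:R]/(i%:Z%:~R).
  rewrite -intrD {1}(divz_eq (i%:Z + x) k) !intrD addrK intrM.
  by rewrite -[k%:Z%:~R]/(k%:R).
apply/eqmodP/asboolP => /=.
exists ((((jump_src j).1%:Z + (jump_dir j).1) %/ m)%Z),
  ((((jump_src j).2%:Z + (jump_dir j).2) %/ n)%Z).
by rewrite -!shiftE /jump_src /jump_dir /= !mulrNz; split; ring.
Qed.

Lemma jump_path1 j : jump_path j 1 = vertex_point (jump_tgt j).
Proof. by rewrite -[1]subr0 -jump_path_rev jump_path0. Qed.

Definition edge_path (e : edge m n) (u : vertex m n) : R -> torus :=
  jump_path (orient e u).

(* The trailing constant path at the base point only reparametrizes the loop. *)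
Definition tour_loop (t : tour m n) : R -> torus :=
  match t with
  | ConstantTour _ => cst torus_base
  | HamiltonianTour v e _ _ _ _ _ =>
      foldr (@path_concat R torus) (cst torus_base)
        [seq edge_path (e i) (v i) | i <- enum 'I_(m * n)]
  end.

Definition supports_nullhomotopic_tour : Prop :=
  exists t : tour m n, nullhomotopic torus_base (tour_loop t).

End Torus.

(* Main.v *)
Require Import Defs.
From mathcomp Require Import all_boot all_order all_algebra generic_quotient.
From mathcomp Require Import ring zify lra.
From mathcomp Require Import all_classical all_reals all_analysis.
Import Order.TTheory GRing.Theory Num.Theory.
Import numFieldNormedType.Exports.

(* A tour lifts to a polygon in the plane, and the tour is nullhomotopic exactly
   when this polygon is closed.

   If m and n are odd, the polygon has mn sides, each changing the parity of
   x + y, so it cannot close up.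

   If m = 2 mu, one needs a closed knight's cycle in Z^2 that meets every class
   modulo m Z x n Z once.  Let L = lcm(mu, n), g = gcd(mu, n).  The path
   p_i = (2 i, i - 2 floor(i / L)) moves by (2, 1) or (2, -1) and runs through
   the cosets of <(2, 1)>, of order L, one after the other.  If g is odd, the
   p_i with i < L g represent all classes with x even; following p and coming
   back along p + (1, 2) gives the cycle.  If g is even, the p_i with
   i < L g / 2 only represent the classes with x even and x / 2 + y even, and
   two such ladders, one translated by (-2, 0), are needed.  They are merged by
   deleting the edges p_0 p_1 and q_0 q_1, where q = p + (-2, 0) + (1, 2), and
   adding p_0 q_0 and p_1 q_1, which are parallel to (-1, 2). *)

Set Implicit Arguments.
Unset Strict Implicit.
Unset Printing Implicit Defensive.

Local Open Scope classical_set_scope.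
Local Open Scope ring_scope.
Local Open Scope quotient_scope.

(** * Closed transversals of knight moves *)

Definition knight_step (p q : int * int) : bool := knight_pair (q - p).

Definition reduce (m n : nat) (p : int * int) : int * int :=
  ((p.1 %% m)%Z, (p.2 %% n)%Z).

(** The cycle closes in the plane itself, not only modulo [m] and [n]; this is what makes the lift
    of the resulting tour closed. Length [m * n] together with distinct reductions forces every
    residue class to occur exactly once. *)
Definition closed_transversal (m n : nat) (s : seq (int * int)) : Prop :=
  [/\ size s = (m * n)%N, head 0 s = 0, cycle knight_step s
    & uniq (map (reduce m n) s)].

Lemma knight_pairC x y : knight_pair (y, x) = knight_pair (x, y).
Proof.
rewrite /knight_pair /= !inE !xpair_eqE.
by rewrite orbC andbC [X in _ || X]andbC.
Qed.

Lemma closed_transversal_swap m n s :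
  closed_transversal m n s -> closed_transversal n m (map swap_pair s).
Proof.
move=> [sz hd cyc un]; split; first by rewrite size_map sz mulnC.
    by case: s hd {sz cyc un} => //= p s ->.
  by rewrite cycle_map (eq_cycle (e' := knight_step)) // => p q; exact: knight_pairC.
rewrite -map_comp (@eq_map _ _ _ (swap_pair \o reduce m n)) //.
by rewrite map_comp map_inj_uniq //; exact: can_inj swap_pairK.
Qed.

Lemma dvdz_small_eq0 (d : nat) (e : int) : (d %| e)%Z -> (`|e| < d)%N -> e = 0.
Proof.
move=> de ed; apply/eqP; rewrite -absz_eq0; apply/eqP; case: (posnP `|e|) => // e0.
by have := dvdn_leq e0 de; rewrite leqNgt ed.
Qed.

(** * Lattice ladders built from translated combs *)

Section Comb.
Variables (mu n : nat).
Hypotheses (mu0 : (0 < mu)%N) (n0 : (0 < n)%N).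
Let L := lcmn mu n.
Let g := gcdn mu n.

(* [comb (b, c) i] is the point p_i + b (1, 2) + c (-2, 0), with p as above. *)
Definition comb (bc : bool * bool) (i : nat) : int * int :=
  (i%:Z *+ 2 + bc.1%:Z - bc.2%:Z *+ 2,
   i%:Z - (i %/ lcmn mu n)%:Z *+ 2 + bc.1%:Z *+ 2).

Let L0 : (0 < L)%N. Proof. by rewrite lcmn_gt0 mu0. Qed.

Lemma knight_comb bc i : knight_step (comb bc i) (comb bc i.+1).
Proof.
rewrite /knight_step /knight_pair /comb /= divnS //.
case: (_ %| i.+1)%N => /=; rewrite !inE; apply/orP; right; apply/eqP; congr (_, _); lia.
Qed.

Lemma comb_inj (K : nat) bc bc' i j :
  (forall e : int, (g %| e *+ 2)%Z -> (K %| e)%Z) ->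
  (bc.2 = bc'.2 \/ ~~ odd mu /\ ~~ odd n) ->
  (i < L * K)%N -> (j < L * K)%N ->
  reduce mu.*2 n (comb bc i) = reduce mu.*2 n (comb bc' j) -> (bc, i) = (bc', j).
Proof.
move: bc bc' => [b c] [b' c'] /= gK hc iK jK [].
move=> /eqP; rewrite eqz_mod_dvd => /dvdzP[u ux].
move=> /eqP; rewrite eqz_mod_dvd => ny.
(* The first coordinates agree modulo an even number and have the parities of [b] and [b']. *)
have eb : b = b' by clear -ux; lia.
rewrite {}eb in ux ny *.
(* If [c] and [c'] differ with [mu] and [n] even, then i - j is odd by the first congruence and even
   by the second. *)
have ec : c = c'.
  case: hc => [//|[em en]]; have /dvdzP[v vx] := ny.
  have [k1 k1E] : exists k, mu = k.*2 by exists (mu./2); lia.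
  have [k2 k2E] : exists k, n = k.*2 by exists (n./2); lia.
  rewrite k2E -!mul2n ?PoszM mulrCA in vx; rewrite k1E -!mul2n ?PoszM mulrA mulrCA in ux.
  rewrite mulrCA in ux.
  move: ux vx; set A := u * _; set B := v * _; clear; lia.
rewrite {}ec in ux ny *.
have md : (mu %| i%:Z - j%:Z)%Z.
  apply/dvdzP; exists u; move: ux; rewrite -mul2n PoszM mulrCA; set A := u * _; clear; lia.
set d := i%:Z - j%:Z in md.
set e := (i %/ L)%:Z - (j %/ L)%:Z.
have nd : (n %| d - e *+ 2)%Z.
  by congr (_ %| _)%Z: ny; rewrite /d /e; ring.
have ge : (g %| e *+ 2)%Z.
  have gm : (g %| mu)%N by exact: dvdn_gcdl.
  have gn : (g %| n)%N by exact: dvdn_gcdr.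
  have -> : e *+ 2 = d - (d - e *+ 2) by ring.
  by rewrite rpredB //; [exact: dvdz_trans md|exact: dvdz_trans nd].
have e0 : e = 0.
  apply: dvdz_small_eq0 (gK _ ge) _.
  have : (i %/ L < K)%N by rewrite ltn_divLR // mulnC.
  have : (j %/ L < K)%N by rewrite ltn_divLR // mulnC.
  rewrite /e; move: (i %/ L)%N (j %/ L)%N; clear; lia.
have Ld : (L %| d)%Z.
  rewrite e0 mul0rn subr0 in nd.
  suff: (L %| `|d|%N)%N by [].
  by rewrite dvdn_lcm; apply/andP; split.
have : d = 0.
  apply: dvdz_small_eq0 Ld _; rewrite /d (divn_eq i L) (divn_eq j L).
  have -> : (i %/ L = j %/ L)%N by move: e0; rewrite /e; clear; lia.
  have := ltn_pmod i L0; have := ltn_pmod j L0.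
  move: (i %% L)%N (j %% L)%N (j %/ L * L)%N; clear; lia.
by rewrite /d => dd; congr (_, _); move: dd; clear; lia.
Qed.

Lemma path_comb bc i k :
  path knight_step (comb bc i) (map (comb bc) (iota i.+1 k)).
Proof. by elim: k i => //= k IH i; rewrite knight_comb IH. Qed.

Lemma last_comb bc i k :
  last (comb bc i) (map (comb bc) (iota i.+1 k)) = comb bc (i + k).
Proof. by elim: k i => [|k IH] i; rewrite ?addn0 //= IH addSnnS. Qed.

Lemma belast_comb bc i k :
  belast (comb bc i) (map (comb bc) (iota i.+1 k)) = map (comb bc) (iota i k).
Proof. by elim: k i => [//|k IH] i; rewrite [LHS]/= IH. Qed.

Lemma knight_step_sym : symmetric knight_step.
Proof.
by move=> p q; rewrite /knight_step /knight_pair -[in RHS](opprB q p) /= !abszN.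
Qed.

Lemma path_rev_comb bc i k :
  path knight_step (comb bc (i + k)) (rev (map (comb bc) (iota i k))).
Proof.
have := rev_path knight_step (comb bc i) (map (comb bc) (iota i.+1 k)).
rewrite last_comb belast_comb => ->; rewrite (eq_path (e' := knight_step)) ?path_comb //.
by move=> p q; rewrite /= knight_step_sym.
Qed.

Lemma last_rev_comb bc i k :
  last (comb bc (i + k)) (rev (map (comb bc) (iota i k))) = comb bc i.
Proof. by case: k => [|k]; rewrite ?addn0 //= rev_cons last_rcons. Qed.

Lemma rev_comb_rcons bc i k : rev (map (comb bc) (iota i k.+1)) =
  comb bc (i + k) :: rev (map (comb bc) (iota i k)).
Proof. by rewrite -addn1 iotaD map_cat rev_cat. Qed.

(** Distinctness is checked on labels [(bc, i)], where it is immediate, and then carried over to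
    residues by [comb_inj]. *)
Lemma uniq_comb_index (bc : bool * bool) i k :
  uniq [seq (bc, j) | j <- iota i k].
Proof. by rewrite map_inj_uniq ?iota_uniq // => j j' []. Qed.

Lemma comb_index_disjoint (bc bc' : bool * bool) i k (t : seq nat) :
  bc != bc' ->
  has (mem [seq (bc, j) | j <- iota i k]) [seq (bc', j) | j <- t] = false.
Proof.
move=> hb; apply/hasP => -[_ /mapP[j _ ->] /mapP[j' _ [eb _]]].
by rewrite eb eqxx in hb.
Qed.

(** Both closing moves are rungs, parallel to (1, 2). Since [g] is odd, [g] dividing 2e forces it to
    divide e, so [comb_inj] applies with [K] equal to [g]. *)
Lemma ladder_transversal (odd_g : odd g) :
  exists s, closed_transversal mu.*2 n s.
Proof.
have mn : (0 < mu * n)%N by rewrite muln_gt0 mu0.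
have [k kE] : exists k, (mu * n = k.+1)%N by exists (mu * n).-1; lia.
exists (map (comb (false, false)) (iota 0 k.+1) ++
        rev (map (comb (true, false)) (iota 0 k.+1))); split.
- by rewrite size_cat size_rev !size_map size_iota -kE -doubleMl addnn.
- by rewrite /= /comb div0n.
- rewrite rev_comb_rcons /= rcons_path cat_path last_cat /= !last_comb.
  rewrite !path_comb path_rev_comb last_rev_comb /knight_step /knight_pair /comb /= !inE !add0n.
  by apply/andP; split; [apply/andP; split=> //|]; apply/orP; left; apply/eqP; congr (_, _); lia.
- pose t : seq ((bool * bool) * nat) := [seq ((false, false), i) | i <- iota 0 k.+1] ++
     rev [seq ((true, false), i) | i <- iota 0 k.+1].
  have -> : map (reduce mu.*2 n)
      (map (comb (false, false)) (iota 0 k.+1) ++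
        rev (map (comb (true, false)) (iota 0 k.+1)))
    = map (fun x => reduce mu.*2 n (comb x.1 x.2)) t.
    by rewrite /t !map_cat !map_rev -!map_comp.
  rewrite map_inj_in_uniq.
    by rewrite cat_uniq rev_uniq !uniq_comb_index has_rev comb_index_disjoint.
  have tP x : x \in t -> ~~ x.1.2 /\ (x.2 < L * g)%N.
    rewrite mem_cat mem_rev muln_lcm_gcd kE.
    by move=> /orP[] /mapP[i]; rewrite mem_iota => ik ->.
  move=> [bc i] [bc' j] /tP[/= c ik] /tP[/= c' jk]; apply: comb_inj ik jk => //.
    by move=> e; rewrite -mulr_natr Gauss_dvdzl // coprimezE/= coprimen2.
  by left; rewrite (negbTE c) (negbTE c').
Qed.

Lemma merged_transversal (emu : ~~ odd mu) (en : ~~ odd n) :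
  exists s, closed_transversal mu.*2 n s.
Proof.
have g2 : (g = g./2.*2)%N.
  rewrite -[LHS]odd_double_half; suff /negbTE-> : ~~ odd g by [].
  by rewrite -dvdn2 dvdn_gcd !dvdn2 emu.
have g0 : (0 < g)%N by rewrite gcdn_gt0 mu0.
have lg : (L * g = mu * n)%N by rewrite muln_lcm_gcd.
have L1 : (1 < L)%N.
  have /dvdn_leq := dvdn_lcml mu n; rewrite -/L L0 => /(_ isT); lia.
(* Each rail has at least two points, since the merge uses those of index 0 and 1. *)
have [k kE] : exists k, (L * g./2 = k.+2)%N.
  exists (L * g./2).-2; have : (L <= L * g./2)%N by rewrite leq_pmulr //; lia.
  by lia.
(* The order of travel: cross from p_0 to q_0, take the rung to the lower rail of the second ladder,
   run up it and back down the upper rail to q_1, cross to p_1, then run up the first lower rail and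
   down the first upper rail to the rung at p_0. *)
pose t : seq ((bool * bool) * nat) :=
  ((false, false), 0%N) :: ((true, true), 0%N) ::
    [seq ((false, true), i) | i <- iota 0 k.+2] ++
    rev [seq ((true, true), i) | i <- iota 1 k.+1] ++
    [seq ((false, false), i) | i <- iota 1 k.+1] ++
    rev [seq ((true, false), i) | i <- iota 0 k.+2].
exists (map (fun x => comb x.1 x.2) t); split.
- rewrite size_map /t -cat1s -(cat1s (_, 0%N) (_ ++ _)) !size_cat !size_rev !size_map !size_iota.
  have -> : (mu.*2 * n = L * g./2 * 4)%N.
    by rewrite -doubleMl -lg {1}g2 -doubleMr -!muln2 -!mulnA.
  by rewrite kE /=; lia.
- by rewrite /= /comb div0n.
- have pairK bc r : [seq comb x.1 x.2 | x <- [seq (bc, i) | i <- r]] = map (comb bc) r.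
    by rewrite -map_comp.
  have combS bc i j : map (comb bc) (iota i j.+1) = comb bc i :: map (comb bc) (iota i.+1 j).
    by [].
  have rung c i : knight_step (comb (false, c) i) (comb (true, c) i).
    rewrite /knight_step /knight_pair !inE; apply/orP; left.
    by apply/eqP; congr (_, _); rewrite /comb /=; lia.
  have cross i : knight_step (comb (false, false) i) (comb (true, true) i).
    rewrite /knight_step /knight_pair !inE; apply/orP; left.
    by apply/eqP; congr (_, _); rewrite /comb /=; lia.
  have -> : map (fun x => comb x.1 x.2) t =
      comb (false, false) 0 :: comb (true, true) 0 ::
        map (comb (false, true)) (iota 0 k.+2) ++
        rev (map (comb (true, true)) (iota 1 k.+1)) ++
        map (comb (false, false)) (iota 1 k.+1) ++
        rev (map (comb (true, false)) (iota 0 k.+2)).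
    by rewrite /t 2!map_cons !(map_cat, map_rev) !pairK.
  rewrite (rev_comb_rcons (true, true) 1 k) (rev_comb_rcons (true, false) 0 k.+1).
  rewrite (combS (false, true)) (combS (false, false)).
  (* Both sides are the last index of a rail; naming it [K] keeps the index ranges from unfolding
     under simplification. *)
  have E : (1 + k = 0 + k.+1)%N by [].
  rewrite E; move: (k.+1) E => K E.
  rewrite [cycle _ _]/= rcons_path !(cat_path, last_cat) /= !(cat_path, last_cat) /=.
  rewrite !(cat_path, last_cat) /=.
  rewrite !last_comb !path_comb !path_rev_comb !last_rev_comb.
  have := path_rev_comb (true, true) 1 k; have := last_rev_comb (true, true) 1 k.
  rewrite E => -> ->.
  by rewrite ![knight_step (comb (true, _) _) _]knight_step_sym !cross !rung.
- rewrite -map_comp map_inj_in_uniq.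
    rewrite /t.
    have inr (bc bc' : bool * bool) i j l :
        ((bc, i) \in [seq (bc', i0) | i0 <- iota j l]) = (bc == bc') && (j <= i < j + l)%N.
      apply/mapP/andP => [[i' + [-> ->]]|[/eqP-> ij]]; first by rewrite mem_iota.
      by exists i => //; rewrite mem_iota.
    rewrite 2!cons_uniq inE !(mem_cat, mem_rev) !inr.
    rewrite !cat_uniq !rev_uniq !uniq_comb_index !has_cat !has_rev.
    have has_revl (s1 s2 : seq (bool * bool * nat)) : has (mem (rev s1)) s2 = has (mem s1) s2.
      by apply: eq_has => x; rewrite /= mem_rev.
    by rewrite !has_revl !comb_index_disjoint.
  have tP x : x \in t -> (x.2 < L * g./2)%N.
    rewrite 2!in_cons kE !(mem_cat, mem_rev).
    case/or3P=> [/eqP->|/eqP->|]//.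
    by case/or4P=> /mapP[i]; rewrite mem_iota => /andP[_ ik] ->.
  move=> [bc i] [bc' j] /tP ik /tP jk; apply: comb_inj ik jk => //; last by right.
  move=> e; rewrite -/g => /dvdzP[x xE]; apply/dvdzP; exists x; move: xE.
  rewrite {1}g2 -muln2 PoszM mulrA; move: (x * _); clear; lia.
Qed.

End Comb.

Lemma even_closed_transversal m n : (0 < m)%N -> (0 < n)%N -> ~~ odd m ->
  exists s, closed_transversal m n s.
Proof.
move=> m0 n0 em; have mE : m = (m./2).*2 by lia.
have mu0 : (0 < m./2)%N by lia.
rewrite mE; have [og|eg] := boolP (odd (gcdn m./2 n)).
  exact: ladder_transversal.
have : (2 %| gcdn m./2 n)%N by rewrite dvdn2.
by rewrite dvdn_gcd !dvdn2 => /andP[emu en]; apply: merged_transversal.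
Qed.

Lemma ex_closed_transversal m n : (0 < m)%N -> (0 < n)%N ->
  ~~ odd m \/ ~~ odd n -> exists s, closed_transversal m n s.
Proof.
move=> m0 n0 [em|en]; first exact: even_closed_transversal.
have [s ss] := even_closed_transversal n0 m0 en.
by exists (map swap_pair s); exact: closed_transversal_swap.
Qed.

(** * Polygons in the plane *)

(** Two closed half-lines cover the line, and at their common point 1/2 the pieces agree because
    [f 1 = g 0]. *)
Lemma path_concat_continuous (R : realType) (X : topologicalType) (f g : R -> X) :
  continuous f -> continuous g -> f 1 = g 0 -> continuous (path_concat f g).
Proof.
move=> cf cg fg.
have eqW (A : set R) (h k : R -> X) :
    {in A, h =1 k} -> continuous h -> {within A, continuous k}.
  by move=> hk ch; apply: subspace_eq_continuous hk _; exact: continuous_subspaceT.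
apply/continuous_subspace_setT.
have -> : [set: R] = [set x | x <= 2^-1] `|` [set x | x >= 2^-1].
  by rewrite eqEsubset; split=> x _ //=; apply/orP; exact: le_total.
apply: withinU_continuous; [exact: closed_le|exact: closed_ge| |].
  apply: (eqW _ (fun s => f (2 * s))).
    by move=> x; rewrite inE /path_concat /= => ->.
  move=> x.
  by apply: (@cvg_comp _ _ _ ( *%R 2) f _ (nbhs (2 * x))); [exact: mulrl_continuous|exact: cf].
apply: (eqW _ (fun s => g (2 * s - 1))).
  move=> x; rewrite inE /path_concat /= => x2; case: ifP => // x2'.
  have -> : x = 2^-1 by apply/eqP; rewrite eq_le x2 x2'.
  by rewrite divff ?subrr ?fg.
move=> x; apply: (@cvg_comp _ _ _ (fun y => 2 * y - 1) g _ (nbhs (2 * x - 1))); last exact: cg.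
by apply: cvgB; [exact: mulrl_continuous|exact: cvg_cst].
Qed.

Section Lift.
Variable R : realType.

Definition segment (c : R * R) (d : int * int) (s : R) : R * R :=
  (c.1 + d.1%:~R * s, c.2 + d.2%:~R * s).

(** The nesting of [path_concat] and the trailing constant path copy [tour_loop], so that the loop
    is the projection of a polygon with no reparametrization. The point [segment c d 1] is [c]
    translated by [d]. *)
Fixpoint polygon (c : R * R) (ds : seq (int * int)) : R -> R * R :=
  if ds is d :: ds' then path_concat (segment c d) (polygon (segment c d 1) ds')
  else cst c.

Lemma segment0 c d : segment c d 0 = c.
Proof. by rewrite /segment !mulr0 !addr0; case: c. Qed.

Lemma polygon0 c ds : polygon c ds 0 = c.
Proof.
by case: ds => //= d ds; rewrite /path_concat invr_ge0 ler0n mulr0 segment0.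
Qed.

Lemma polygon1 c ds : polygon c ds 1 = segment c (\sum_(d <- ds) d) 1.
Proof.
elim: ds c => [|d ds IH] c; first by rewrite big_nil /segment !mul0r !addr0; case: c.
rewrite /= /path_concat ifF; last by apply/negbTE; rewrite -ltNge; lra.
have -> : 2 * 1 - 1 = 1 :> R by ring.
by rewrite IH big_cons /segment /= !intrD; congr (_, _); ring.
Qed.

Lemma segment_continuous c d : continuous (segment c d).
Proof.
have affine (a b : R) : continuous (fun s => a + b * s).
  by move=> s; apply: cvgD; [exact: cvg_cst|exact: mulrl_continuous].
by move=> s; exact: (cvg_pair (affine c.1 d.1%:~R s) (affine c.2 d.2%:~R s)).
Qed.

Lemma polygon_continuous c ds : continuous (polygon c ds).
Proof.
elim: ds c => [|d ds IH] c /=; first by move=> s; exact: cvg_cst.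
by apply: path_concat_continuous; [exact: segment_continuous|exact: IH|rewrite polygon0].
Qed.

End Lift.

(** * Projections of closed planar loops are contractible *)

Section TorusLoops.
Variables (R : realType) (m n : nat).
Let T := torus R m n.
Let p : R * R -> T := \pi_T.

Lemma torus_pi_continuous : continuous p.
Proof. exact: pi_continuous. Qed.

(** The loop is contracted to [c] along straight lines in the plane; the endpoints, already at [c],
    stay fixed, and the contraction is then projected to the torus. *)
Lemma straight_line_nullhomotopic (F : R -> R * R) c :
  continuous F -> F 0 = c -> F 1 = c -> nullhomotopic (p c) (p \o F).
Proof.
move=> cF F0 F1; split.
  split; rewrite /= ?F0 ?F1 //; apply: continuous_subspaceT => s.
  by apply: continuous_comp; [exact: cF|exact: torus_pi_continuous].
pose H0 (z : R * R) : R * R := F z.1 + z.2 *: (c - F z.1).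
exists (p \o H0); split.
- apply: continuous_subspaceT => z.
  apply: continuous_comp; last exact: torus_pi_continuous.
  have cF1 : {for z, continuous (F \o fst)}.
    by apply: continuous_comp; [exact: cvg_fst|exact: cF].
  apply: cvgD; first exact: cF1.
  by apply: cvgZ; [exact: cvg_snd|apply: cvgB; [exact: cvg_cst|exact: cF1]].
- by move=> s _; rewrite /H0 /= scale0r addr0 scale1r addrC subrK.
- by move=> t _; rewrite /H0 /= F0 F1 subrr scaler0 addr0.
Qed.

End TorusLoops.

(** * Lifting tours *)

Section TourLift.
Variables (R : realType) (m n : nat).
Let T := torus R m n.
Let p : R * R -> T := \pi_T.

Lemma pi_segment (c c' : R * R) d s :
  p c = p c' -> p (segment c d s) = p (segment c' d s).
Proof.
move=> /eqmodP/asboolP[k [l [h1 h2]]]; apply/eqmodP/asboolP; exists k, l.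
by rewrite -h1 -h2 /segment /=; split; ring.
Qed.

Fixpoint jump_walk (u : vertex m n) (js : seq (jump m n)) (w : vertex m n) :
    bool :=
  if js is j :: js' then (jump_src j == u) && jump_walk (jump_tgt j) js' w
  else u == w.

(** Explicit path lifting: a jump path is the projection of a segment issued from any lift [c] of
    its source, and the end of that segment is the lift used for the next jump. *)
Lemma foldr_jump_path (js : seq (jump m n)) (c : R * R) (u w : vertex m n) :
  p c = vertex_point R u -> jump_walk u js w ->
  foldr (@path_concat R T) (cst (vertex_point R w)) (map (@jump_path R m n) js)
  = p \o polygon c (map (@jump_dir m n) js).
Proof.
elim: js c u => [|j js IH] c u pc /=; first by move=> /eqP<-; rewrite -pc.
move=> /andP[/eqP ju wj].
have pcj (s : R) : jump_path j s = p (segment c (jump_dir j) s).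
  pose c' : R * R := ((jump_src j).1%:R + 2^-1, (jump_src j).2%:R + 2^-1).
  by apply: (@pi_segment c' c); rewrite pc -ju.
rewrite (IH (segment c (jump_dir j) 1) (jump_tgt j)) //; last first.
  by rewrite -pcj jump_path1.
by apply/funext => s; rewrite /path_concat /=; case: ifP.
Qed.

Lemma jump_walk_nth (u w : vertex m n) js :
  (0 < size js)%N ->
  (forall i (j0 : jump m n), (i.+1 < size js)%N ->
     jump_tgt (nth j0 js i) = jump_src (nth j0 js i.+1)) ->
  (forall j0, jump_src (nth j0 js 0) = u) ->
  (forall j0, jump_tgt (nth j0 js (size js).-1) = w) ->
  jump_walk u js w.
Proof.
elim: js u => // j js IH u _ hs hu hw /=; rewrite (hu j) eqxx /=.
case: js IH hs hu hw => [|j' js] IH hs hu hw; first by rewrite (hw j) /=.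
apply: IH => //.
- by move=> i j0 ij; exact: (hs i.+1 j0).
- by move=> j0; rewrite -(hs 0%N j0).
Qed.

End TourLift.

Section HamiltonianLoop.
Variables (R : realType) (m n : nat).
Variables (v : 'I_(m * n) -> vertex m n) (e : 'I_(m * n) -> edge m n).
Hypothesis v0 : forall i : 'I_(m * n), i = 0%N :> nat ->
       (v i).1 = 0%N :> nat /\ (v i).2 = 0%N :> nat.
Hypothesis je : forall i, joins (e i) (v i) (v (ordS i)).
Let js := [seq orient (e i) (v i) | i <- enum 'I_(m * n)].

Definition tour_dir (i : 'I_(m * n)) := jump_dir (orient (e i) (v i)).

(** The oriented edges form a closed walk: [ordS] is the ordinary successor below the last index and
    wraps to 0 there. The walk starts over the base point by [v0]. *)
Lemma tour_loop_lift (N0 : (0 < m * n)%N) :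
  foldr (@path_concat R (torus R m n)) (cst (torus_base R m n))
        [seq edge_path (e i) (v i) | i <- enum 'I_(m * n)]
  = (\pi_(torus R m n) : R * R -> _) \o
      polygon (2^-1, 2^-1) [seq tour_dir i | i <- enum 'I_(m * n)].
Proof.
pose i0 := Ordinal N0.
have b0 : vertex_point R (v i0) = torus_base R m n.
  by rewrite /vertex_point; have [-> ->] := v0 (erefl : i0 = 0%N :> nat); rewrite add0r.
have szj : size js = (m * n)%N by rewrite size_map size_enum_ord.
have nthj j0 (i : 'I_(m * n)) : nth j0 js i = orient (e i) (v i).
  by rewrite (nth_map i0) ?size_enum_ord // nth_ord_enum.
have -> : [seq tour_dir i | i <- enum 'I_(m * n)] = map (@jump_dir m n) js.
  by rewrite /js -[RHS]map_comp.
rewrite -b0 -(@foldr_jump_path R m n js (2^-1, 2^-1) (v i0) (v i0)).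
- by rewrite /js -[in RHS]map_comp.
- by rewrite b0.
apply: jump_walk_nth; first by rewrite szj.
- move=> i j0; rewrite szj => iN.
  have iN' : (i < m * n)%N by exact: ltnW.
  have := nthj j0 (Ordinal iN'); have := nthj j0 (Ordinal iN) => /= -> ->.
  have [_ _ ->] := orientP (je (Ordinal iN')).
  have [_ -> _] := orientP (je (Ordinal iN)).
  by congr v; apply/val_inj; rewrite /= modn_small.
- by move=> j0; rewrite (nthj j0 i0); have [] := orientP (je i0).
- move=> j0; rewrite szj.
  have lN : ((m * n).-1 < m * n)%N by rewrite prednK.
  have := nthj j0 (Ordinal lN) => /= ->.
  have [_ _ ->] := orientP (je (Ordinal lN)).
  by congr v; apply/val_inj; rewrite /= prednK // modnn.
Qed.

End HamiltonianLoop.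

(** * From transversals to tours *)

Lemma cycle_nth (T : Type) (r : rel T) x0 (s : seq T) (i : nat) :
  cycle r s -> (i < size s)%N -> r (nth x0 s i) (nth x0 s (i.+1 %% size s)).
Proof.
case: s => // x s /(pathP x0) h si; have := h i.
rewrite size_rcons => /(_ si); rewrite -rcons_cons !nth_rcons si.
have [is_|] := ltnP i (size s); first by rewrite modn_small.
move=> si'; have -> : i = size s by apply/eqP; rewrite eqn_leq si' andbT.
by rewrite eqxx /= modnn.
Qed.

Lemma shift_shift k (i : 'I_k) x y :
  Defs.shift (Defs.shift i x) y = Defs.shift i (x + y).
Proof.
apply/val_inj; apply: (can_inj absz_nat).
by rewrite !val_shift modzDml addrA.
Qed.

Lemma knight_pair_sum_odd d : knight_pair d -> odd `|(d.1 + d.2)%R|%N.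
Proof. by case: d => x y; rewrite /knight_pair !inE !xpair_eqE /=; lia. Qed.

Section OfTransversal.
Variables (m n : nat) (s : seq (int * int)).
Hypotheses (m0 : (0 < m)%N) (n0 : (0 < n)%N) (N3 : (2 < m * n)%N).
Hypothesis ts : closed_transversal m n s.
Let N := (m * n)%N.

Let position (i : 'I_N) := nth 0 s i.
Let vtx (q : int * int) : vertex m n :=
  (Defs.shift (Ordinal m0) q.1, Defs.shift (Ordinal n0) q.2).
Let visit (i : 'I_N) := vtx (position i).

Lemma position_knight i : knight_pair (position (ordS i) - position i).
Proof.
case: ts => sz _ cyc _; have := @cycle_nth _ _ 0 s i cyc.
by rewrite sz ltn_ord => /(_ isT).
Qed.

Let visit_jump i : jump m n := exist (fun k : (int * int) * vertex m n => knight_pair k.1)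
  (position (ordS i) - position i, visit i) (position_knight i).

Lemma visit_jump_tgt i : jump_tgt (visit_jump i) = visit (ordS i).
Proof.
rewrite /jump_tgt /jump_src /jump_dir /= !shift_shift /visit /vtx.
by congr (Defs.shift _ _, Defs.shift _ _); rewrite addrC subrK.
Qed.

Lemma visit_inj : injective visit.
Proof.
case: ts => sz _ _ un i j vij.
have iN (k : 'I_N) : (k < size s)%N by rewrite sz.
apply/val_inj/eqP => /=.
rewrite -(nth_uniq 0 _ _ un) ?size_map // !(nth_map 0) //.
have eqs : (visit i).1%:Z = (visit j).1%:Z /\ (visit i).2%:Z = (visit j).2%:Z by rewrite vij.
by move: eqs; rewrite /visit /vtx !val_shift !add0r => -[h1 h2]; rewrite /reduce h1 h2.
Qed.

Lemma ordS_neq (i : 'I_N) : ordS i != i.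
Proof.
apply/eqP => /(congr1 val) /=; have [iN|] := ltnP i.+1 N; first by rewrite modn_small //; lia.
move=> Ni; have -> : i.+1 = N by have := ltn_ord i; lia.
by rewrite modnn => i0; move: Ni; rewrite -i0 /N; lia.
Qed.

Lemma ordS2_neq (i : 'I_N) : ordS (ordS i) != i.
Proof.
apply/eqP => /(congr1 val) /=; rewrite -addn1 modnDml addn1.
have iN := ltn_ord i.
have [h|h] := ltnP i.+2 N; first by rewrite modn_small //; lia.
rewrite -(modnDr _ N) (_ : (i.+2 + N = (i.+2 - N) + N + N)%N); last by lia.
by rewrite !modnDr modn_small; lia.
Qed.

Let visit_edge i : edge m n := \pi_(edge m n) (visit_jump i).

Lemma visit_edge_joins i : joins (visit_edge i) (visit i) (visit (ordS i)).
Proof. by exists (visit_jump i); split => //; exact: visit_jump_tgt. Qed.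

(** Equal edges come from equal jumps, whose sources determine the index, or from mutually reversed
    jumps. In the latter case [i] and [j] are cyclic successors of each other, which is impossible
    on more than two indices. *)
Lemma visit_edge_inj : injective visit_edge.
Proof.
move=> i j /eqmodP/orP[/eqP/(congr1 (@jump_src m n))/visit_inj//|/eqP h].
have h1 := congr1 (@jump_src m n) h; have h2 := congr1 (@jump_tgt m n) h.
have E k : jump_src (jump_rev k) = jump_tgt k :> vertex m n by [].
rewrite E visit_jump_tgt in h1; rewrite -[jump_tgt (jump_rev _)]E jump_revK visit_jump_tgt in h2.
move/visit_inj: h1 => h1; move/visit_inj: h2 => h2.
by have := ordS2_neq i; rewrite -h1 h2 eqxx.
Qed.

(** The other representative of the edge starts at the next vertex, which differs from [visit i];
    hence [orient] recovers the jump from which the edge was built. *)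
Lemma visit_dir i : tour_dir visit visit_edge i = position (ordS i) - position i.
Proof.
have [/eqmodP/orP[/eqP h _ _|/eqP h _ ht]] := orientP (visit_edge_joins i).
  by rewrite /tour_dir -h.
have := congr1 (@jump_src m n) h.
rewrite -[jump_src (jump_rev _)]/(jump_tgt _) ht => /visit_inj/eqP.
by rewrite eq_sym (negbTE (ordS_neq i)).
Qed.

(** The sum telescopes cyclically, as [ordS] permutes the indices. *)
Lemma sum_visit_dir : \sum_(d <- [seq tour_dir visit visit_edge i | i <- enum 'I_N]) d = 0.
Proof.
rewrite big_map big_enum /= (eq_bigr _ (fun i _ => visit_dir i)) sumrB.
rewrite [X in X - _](_ : _ = \sum_i position i) ?subrr //.
by rewrite [RHS](reindex_inj (can_inj (@ordSK N))).
Qed.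

Lemma transversal_supports (R : realType) : supports_nullhomotopic_tour R m n.
Proof.
have N1 : (m * n <> 1)%N by lia.
have v0 (i : 'I_N) : i = 0%N :> nat -> (visit i).1 = 0%N :> nat /\ (visit i).2 = 0%N :> nat.
  move=> i0; have -> : visit i = vtx 0.
    by case: ts => _ hd _ _; rewrite /visit /position i0 nth0 hd.
  have sh0 k (k0 : (0 < k)%N) : Defs.shift (Ordinal k0) 0 = 0%N :> nat.
    by rewrite /= addr0 mod0z.
  by split; exact: sh0.
have vb : bijective visit by apply: inj_card_bij; [exact: visit_inj|rewrite card_prod !card_ord].
exists (HamiltonianTour N1 vb v0 visit_edge_inj visit_edge_joins).
rewrite /tour_loop (tour_loop_lift R v0 visit_edge_joins); last lia.
apply: (@straight_line_nullhomotopic R m n _ (2^-1, 2^-1)).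
- exact: polygon_continuous.
- exact: polygon0.
- by rewrite polygon1 sum_visit_dir -{2}(segment0 (2^-1 : R, 2^-1) 0) /segment /= !mul0r.
Qed.

End OfTransversal.

(** * Lifting homotopies *)

Section HomotopyLifting.
Variables (R : realType) (m n : nat).
Hypotheses (m0 : (0 < m)%N) (n0 : (0 < n)%N).
Let T := torus R m n.
Let p : R * R -> T := \pi_T.

Definition box_close (r : R) (c c' : R * R) : Prop :=
  `|c'.1 - c.1| < r /\ `|c'.2 - c.2| < r.

Definition torus_close (r : R) (z w : T) : Prop :=
  exists c c', [/\ p c = z, p c' = w & box_close r c c'].

(** Points of one fibre differ by multiples of [m] and [n], and a nonzero multiple of a positive
    integer has absolute value at least 1. *)
Lemma pi_close_inj c c' : p c = p c' -> box_close 1 c c' -> c = c'.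
Proof.
move=> /eqmodP/asboolP[k [l [hk hl]]] [].
rewrite hk hl.
have small (i : int) (d : nat) : (0 < d)%N -> `|i%:~R * d%:R : R| < 1 -> i = 0.
  move=> d0; rewrite -[d%:R]/(d%:Z%:~R) -intrM -intr_norm -[1]/(1%:~R) ltr_int => h.
  apply/eqP; apply: contraTT h => i0; rewrite -leNgt normrM; nia.
move=> /(small _ _ m0) k0 /(small _ _ n0) l0; move: hk hl.
rewrite k0 l0 !mul0r => /eqP; rewrite subr_eq0 => /eqP h1 /eqP; rewrite subr_eq0 => /eqP h2.
by case: c c' h1 h2 => [a b] [a' b'] /= -> ->.
Qed.

(** Closeness is witnessed by some pair of lifts; a lattice translation moves that pair so that its
    first member is the prescribed [c]. *)
Lemma torus_close_lift r z w c : torus_close r z w -> p c = z ->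
  exists2 c', p c' = w & box_close r c c'.
Proof.
move=> [a [b [<- <- [h1 h2]]]] /eqmodP/asboolP[k [l [hk hl]]].
exists (b.1 - (a.1 - c.1), b.2 - (a.2 - c.2)).
  apply/eqmodP/asboolP; exists k, l; rewrite /= -hk -hl; split; ring.
split=> /=.
  by rewrite (_ : _ - _ = b.1 - a.1) //; ring.
by rewrite (_ : _ - _ = b.2 - a.2) //; ring.
Qed.

(** The projection is open: the preimage of the image of an open box is a union of lattice
    translates of the box. The radius [eps] is the slack left inside the box. *)
Lemma nbhs_torus_close r c : 0 < r ->
  nbhs (p c) [set w | exists2 c', p c' = w & box_close r c c'].
Proof.
move=> r0; apply: open_nbhs_nbhs; split; last first.
  by exists c => //; split; rewrite subrr normr0.
change (open (p @^-1` [set w | exists2 c', p c' = w & box_close r c c'])).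
rewrite openE => y [c' pc' [h1 h2]].
pose eps := Num.min (r - `|c'.1 - c.1|) (r - `|c'.2 - c.2|).
have e0 : 0 < eps by rewrite lt_min !subr_gt0 h1 h2.
apply/nbhs_ballP; exists eps => //= z [/= b1 b2].
move/eqmodP/asboolP: pc' => [k [l [hk hl]]].
exists (c'.1 + (z.1 - y.1), c'.2 + (z.2 - y.2)).
  apply/eqmodP/asboolP; exists k, l; rewrite /= -hk -hl; split; ring.
move: b1 b2; rewrite /ball /= !lt_min => /andP[b1 _] /andP[_ b2]; split=> /=.
  rewrite (_ : _ - _ = (c'.1 - c.1) - (y.1 - z.1)); last by ring.
  by apply: le_lt_trans (ler_normB _ _) _; lra.
rewrite (_ : _ - _ = (c'.2 - c.2) - (y.2 - z.2)); last by ring.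
by apply: le_lt_trans (ler_normB _ _) _; lra.
Qed.

Lemma box_close_trans r r' c1 c2 c3 :
  box_close r c1 c2 -> box_close r' c2 c3 -> box_close (r + r') c1 c3.
Proof.
move=> [a1 a2] [b1 b2]; split.
  rewrite (_ : _ - _ = (c3.1 - c2.1) + (c2.1 - c1.1)); last by ring.
  by apply: le_lt_trans (ler_normD _ _) _; rewrite addrC ltrD.
rewrite (_ : _ - _ = (c3.2 - c2.2) + (c2.2 - c1.2)); last by ring.
by apply: le_lt_trans (ler_normD _ _) _; rewrite addrC ltrD.
Qed.

Lemma box_close_sym r c c' : box_close r c c' -> box_close r c' c.
Proof. by move=> [h1 h2]; split; rewrite distrC. Qed.

End HomotopyLifting.

(** A Lebesgue number argument: a relation that holds within a neighbourhood of each point of a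
    compact set holds for all sufficiently close pairs. Halving the local radius leaves room for the
    triangle inequality. *)
Lemma compact_uniformly (R : realType) (X : pseudoMetricType R) (K : set X)
    (C : X -> X -> Prop) : compact K ->
  (forall x, K x -> exists2 U : set X, nbhs x U &
     forall y z, K y -> K z -> U y -> U z -> C y z) ->
  exists N : nat, forall y z, K y -> K z -> ball y N.+1%:R^-1 z -> C y z.
Proof.
move=> /compact_near_coveringP/near_covering_withinP cK locC.
pose P (k : nat) (y : X) := forall z, K z -> ball y k.+1%:R^-1 z -> C y z.
have [N _ CN] : \forall k \near \oo, K `<=` P k.
  apply: cK => x /locC[U /nbhs_ballP[_/posnumP[e] eU] UC].
  have e0 : 0 < e%:num / 2 by [].
  near=> y k.
  have xy : ball x (e%:num / 2) y by near: y; exact: nbhsx_ballx.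
  have ke : k.+1%:R^-1 < e%:num / 2.
    by near: k; exact: (near_infty_natSinv_lt (PosNum e0)).
  move=> Ky z Kz yz; apply: UC => //; apply: eU.
    by apply: le_ball xy; lra.
  rewrite [e%:num]splitr; apply: ball_triangle xy _.
  by apply: le_ball yz; exact: ltW.
by exists N => y z Ky Kz yz; exact: (CN N (leqnn N) y Ky z Kz yz).
Unshelve. all: by end_near. Qed.

(** * Lifts of nullhomotopic loops are closed *)

Section HomotopyInvariance.
Variables (R : realType) (m n : nat).
Hypotheses (m0 : (0 < m)%N) (n0 : (0 < n)%N).
Let T := torus R m n.
Let p : R * R -> T := \pi_T.

(* The homotopy is sampled on a grid so fine that neighbouring values are within
   1/4 of each other in the torus.  The first row is lifted by F; each row is
   then lifted by the points nearest to the lift of the previous row, which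
   keeps neighbours within 3/4 of each other, hence within 1/4 because distinct
   points of a fibre differ by at least 1 in some coordinate.  The endpoints
   never move, and the last row is constant. *)
Lemma nullhomotopic_lift_closed (F : R -> R * R) x :
  continuous F -> nullhomotopic x (p \o F) -> F 0 = F 1.
Proof.
move=> cF [_ [H [cH Hs Ht]]].
pose K : set (R * R) := `[0, 1] `*` `[0, 1].
have cK : compact K by apply: compact_setX; exact: segment_compact.
have I0 : (0 : R) \in `[0, 1] by rewrite in_itv /= lexx ler01.
have [N CN] : exists N : nat, forall y z, K y -> K z -> ball y N.+1%:R^-1 z ->
    torus_close (1 / 4) (H y) (H z) /\ box_close (1 / 4) (F y.1) (F z.1).
  apply: compact_uniformly cK _ => z Kz.
  (* Two points within 1/8 of a common centre are within 1/4 of each other. *)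
  have e0 : 0 < 1 / 8 :> R by lra.
  pose c := repr (H z).
  have pc : p c = H z by exact: reprK.
  have := nbhs_torus_close m n c e0; rewrite -/p pc => U1.
  have {}U1 : nbhs z [set y | K y -> exists2 c', p c' = H y & box_close (1 / 8) c c'].
    have /subspace_continuousP/(_ z Kz) h := cH.
    exact: (h _ U1).
  have cF1 : {for z, continuous (F \o fst)}.
    by apply: continuous_comp; [exact: cvg_fst|exact: cF].
  have U2 : nbhs z [set y | box_close (1 / 8) (F z.1) (F y.1)].
    have := cF1 _ (nbhsx_ballx (F z.1) (1 / 8) e0); apply: filterS => y [/= b1 b2].
    by split; rewrite distrC.
  exists ([set y | K y -> exists2 c', p c' = H y & box_close (1 / 8) c c'] `&`
          [set y | box_close (1 / 8) (F z.1) (F y.1)]); first exact: filterI.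
  have e8 : 1 / 4 = 1 / 8 + 1 / 8 :> R by lra.
  move=> y w Ky Kw [hy Fy] [hw Fw]; rewrite e8; split; last first.
    by apply: box_close_trans Fw; exact: box_close_sym.
  have [a pa ca] := hy Ky; have [b pb cb] := hw Kw.
  by exists a, b; split => //; apply: box_close_trans cb; exact: box_close_sym.
(* One more than [N.+1], because balls are open and the mesh must be strictly below the radius. *)
pose M := N.+2.
pose q (i : nat) : R := i%:R / M%:R.
have M0 : 0 < M%:R :> R by rewrite ltr0n.
have qI i : (i <= M)%N -> q i \in `[0, 1].
  by move=> iM; rewrite in_itv /= divr_ge0 ?ler0n //= ler_pdivrMr // mul1r ler_nat.
have q0 : q 0%N = 0 by rewrite /q mul0r.
have qM : q M = 1 by rewrite /q divff // gt_eqF.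
have ball_q i : ball (q i) N.+1%:R^-1 (q i.+1).
  rewrite /ball /= /q -mulrBl -natr1 opprD addrA subrr add0r mulN1r normrN.
  by rewrite gtr0_norm ?invr_gt0 // ltf_pV2 ?posrE ?ltr0n // ltr_nat.
have N0 : 0 < N.+1%:R^-1 :> R by rewrite invr_gt0 ltr0n.
have rows j : (j <= M)%N -> exists G : nat -> R * R,
    [/\ forall i, (i <= M)%N -> p (G i) = H (q i, q j),
        forall i, (i < M)%N -> box_close (1 / 4) (G i) (G i.+1),
        G 0%N = F 0 & G M = F 1].
  elim: j => [|j IH] jM.
    exists (fun i => F (q i)); split; rewrite ?q0 ?qM //.
      by move=> i iM; have [->] := Hs _ (qI _ iM).
    move=> i iM; have [] := CN (q i, 0) (q i.+1, 0).
    - by split => //; exact: qI (ltnW iM).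
    - by split => //; exact: qI.
    - by split; [exact: ball_q|exact: ballxx].
    - by [].
  have [G [pG cG G0 GM]] := IH (ltnW jM).
  have step i : exists c', (i <= M)%N -> p c' = H (q i, q j.+1) /\ box_close (1 / 4) (G i) c'.
    have [iM|iM] := leqP i M; last by exists 0.
    have [] := CN (q i, q j) (q i, q j.+1).
    - by split; [exact: qI|exact: qI (ltnW jM)].
    - by split; exact: qI.
    - by split; [exact: ballxx|exact: ball_q].
    move=> h _; have [c' h1 h2] := torus_close_lift h (pG i iM).
    by exists c'.
  have [G' hG'] := choice step.
  exists G'; split.
  - by move=> i /hG'[].
  - move=> i iM; have [p1 c1] := hG' _ (ltnW iM); have [p2 c2] := hG' _ iM.
    have [] := CN (q i, q j.+1) (q i.+1, q j.+1).
    + by split; [exact: qI (ltnW iM)|exact: qI].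
    + by split; exact: qI.
    + by split; [exact: ball_q|exact: ballxx].
    move=> h _; have [c' h1 h2] := torus_close_lift h p1.
    suff <- : c' = G' i.+1 by [].
    apply: (pi_close_inj m0 n0); first exact: etrans h1 (esym p2).
    (* Four moves of size below 1/4 lead from [c'] through [G' i], [G i] and [G i.+1] to [G' i.+1],
       so these two points of one fibre coincide. *)
    have -> : 1 = 1 / 4 + (1 / 4 + (1 / 4 + 1 / 4)) :> R by lra.
    apply: box_close_trans (box_close_sym h2) _; apply: box_close_trans (box_close_sym c1) _.
    by apply: box_close_trans c2; exact: cG.
  - have [p1 c1] := hG' 0%N (leq0n _); rewrite -G0; apply/esym/(pi_close_inj m0 n0).
      rewrite -/p p1 pG // q0; have [-> _] := Ht _ (qI _ jM).
      by have [-> _] := Ht _ (qI _ (ltnW jM)).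
    by case: c1 => ? ?; split; lra.
  - have [p1 c1] := hG' M (leqnn _); rewrite -GM; apply/esym/(pi_close_inj m0 n0).
      rewrite -/p p1 pG // qM; have [_ ->] := Ht _ (qI _ jM).
      by have [_ ->] := Ht _ (qI _ (ltnW jM)).
    by case: c1 => ? ?; split; lra.
have [G [pG cG <- <-]] := rows M (leqnn M).
have : forall i, (i <= M)%N -> G 0%N = G i; last exact.
elim=> // i IH iM; rewrite (IH (ltnW iM)); apply: (pi_close_inj m0 n0).
  rewrite -/p !pG ?(ltnW iM) // qM; have [_ ->] := Hs _ (qI _ iM).
  by have [_ ->] := Hs _ (qI _ (ltnW iM)).
by case: (cG _ iM) => ? ?; split; lra.
Qed.

End HomotopyInvariance.

Lemma sum_knight_pairs_odd (ds : seq (int * int)) : all knight_pair ds ->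
  odd `|((\sum_(d <- ds) d).1 + (\sum_(d <- ds) d).2)%R|%N = odd (size ds).
Proof.
elim: ds => [|d ds IH] /=; first by rewrite big_nil.
by move=> /andP[/knight_pair_sum_odd od /IH]; rewrite big_cons /=; lia.
Qed.

Theorem theorem4p2 (R : realType) (m n : nat)
  (m_gt0 : (0 < m)%N) (n_gt0 : (0 < n)%N) (mn_gt3 : (3 < m + n)%N) :
  supports_nullhomotopic_tour R m n <-> ~~ odd m \/ ~~ odd n.
Proof.
split; last first.
  move=> /(ex_closed_transversal m_gt0 n_gt0)[s ts].
  (* The bound m + n > 3 gives mn > 2, as required for distinct edges. *)
  by apply: (transversal_supports m_gt0 n_gt0 _ ts); nia.
move=> [[mn1|v e mn1 vb v0 ei je] h]; first by nia.
apply/orP; rewrite -negb_and; apply/negP => /andP[om on].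
move: h; rewrite /tour_loop (tour_loop_lift R v0 je) ?muln_gt0 ?m_gt0 //.
move=> /(nullhomotopic_lift_closed m_gt0 n_gt0 (@polygon_continuous _ _ _)).
rewrite polygon0 polygon1; set ds := map _ _.
have : all knight_pair ds.
  by apply/allP => d /mapP[i _ ->]; exact: valP (orient (e i) (v i)).
(* The number of sides mn is odd, so the total displacement has odd coordinate sum, whereas
   closedness makes both coordinates zero. *)
move=> /sum_knight_pairs_odd; rewrite size_map size_enum_ord oddM om on.
case: (\sum_(d <- ds) d) => a b /= odd_ab; rewrite /segment /= => -[] ea eb.
have a0 : a = 0 by apply/eqP; rewrite -(intr_eq0 R); apply/eqP; lra.
have b0 : b = 0 by apply/eqP; rewrite -(intr_eq0 R); apply/eqP; lra.
by rewrite a0 b0 in odd_ab.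
Qed.
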